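(* Let $n>1$ and let $K=\{z_0,z_1,\ldots,z_n\}\subset\mathbb{C}$, where the points $z_0,z_1,\ldots,z_n$ are, in counter-clockwise order, the vertices of a convex $(n+1)$-sided polygon. Indices are taken cyclically, so $z_{n+1}:=z_0$. Let $w\notin K$ be a point in the convex hull of $K$. For every $i=0,\ldots,n$ and every $j\in\{0,\ldots,n\}$ with $z_j\ne z_i,z_{i+1}$, let $\alpha_{i,j}$ be the angle at the vertex $z_j$ of the triangle $\Delta z_iz_{i+1}z_j$, and let $\beta_i$ be the angle at $w$ of the (possibly degenerate) triangle $\Delta z_iz_{i+1}w$. Then $w$ is in the $n$-polynomial hull $\mathcal{P}_n(K)$ of $K$ if and only if, for every $i=0,\ldots,n$, $$\beta_i+\sum_{j}\alpha_{i,j}=\pi,$$ where the sum is over all $j$ with $z_j\neq z_i,z_{i+1}$. If such a point $w$ exists, it is unique.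
   Context: For a compact set $K\subset\mathbb{C}$ and a polynomial $P$ with complex coefficients, $\|P\|_K=\sup_{z\in K}|P(z)|$. For $d\in\mathbb{N}$, the $d$-polynomial hull of $K$ is $\mathcal{P}_d(K)=\{z\in\mathbb{C}:\ |P(z)|\le\|P\|_K\text{ for all polynomials }P\text{ with }\deg P\le d\}$. Angles are unsigned angles in $[0,\pi]$. The vertices of a convex $(n+1)$-sided polygon are $n+1$ distinct points, each an extreme point of their convex hull. *)

(* Defs.v *)
(* The complex plane is R[i] for R : realType; convexity is taken over R,
   through the R-module structure carried by the alias Rcomplex R. *)
From mathcomp Require Import all_boot all_order all_algebra.
From mathcomp Require Import all_classical all_reals all_analysis.
From mathcomp Require Export complex.

Set Implicit Arguments.
Unset Strict Implicit.
Unset Printing Implicit Defensive.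

Import Order.TTheory GRing.Theory Num.Theory.

Local Open Scope classical_set_scope.
Local Open Scope ring_scope.
Local Open Scope convex_scope.

(* The order and norm of R[i] take values in R[i]; the R-valued modulus is
   ComplexField.Normc.normc. *)
Notation cmod := ComplexField.Normc.normc.

(* [sup] is a junk value on empty or unbounded sets, so this is only meaningful
   for nonempty K on which P is bounded, in particular nonempty compact K. *)
Definition poly_norm (R : realType) (K : set R[i]) (P : {poly R[i]}) : R :=
  sup [set cmod P.[z] | z in K].

Definition poly_hull (R : realType) (d : nat) (K : set R[i]) : set R[i] :=
  [set z | forall P : {poly R[i]},
     (size P <= d.+1)%N -> cmod P.[z] <= poly_norm K P].

Definition convex_hull (R : realType) (K : set R[i]) : set R[i] :=
  smallest (@convex_set R (Rcomplex R)) K.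

Definition extreme_point (R : realType) (C : set R[i]) (x : R[i]) : Prop :=
  C x /\
  forall (y z : convex_lmodType (Rcomplex R)) (t : {i01 R}),
    C y -> C z -> 0 < t%:num -> t%:num < 1 -> x = y <| t |> z ->
    y = x /\ z = x.

(* Unsigned angle at p of the triangle a, b, p: Re (u * conj v) is the scalar
   product of u and v, so for a, b distinct from p the argument of acos lies in
   [-1, 1] and the angle in [0, pi]. *)
Definition angle (R : realType) (a b p : R[i]) : R :=
  acos (complex.Re ((a - p) * conjc (b - p)) / (cmod (a - p) * cmod (b - p))).

(* Twice the signed area of the triangle a, b, c; it is positive iff a, b, c are
   not collinear and turn counter-clockwise. *)
Definition orient (R : realType) (a b c : R[i]) : R :=
  complex.Im (conjc (b - a) * (c - a)).

(* Counter-clockwise order on a convex curve is the cyclic order in which any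
   three points taken in turn form a counter-clockwise triangle. *)
Definition ccw_order (R : realType) (m : nat) (z : 'I_m -> R[i]) : Prop :=
  forall i j k : 'I_m, (i < j)%N -> (j < k)%N -> 0 < orient (z i) (z j) (z k).

Definition ccw_convex_polygon (R : realType) (m : nat) (z : 'I_m -> R[i]) : Prop :=
  [/\ injective z,
      forall i, extreme_point (convex_hull (range z)) (z i)
    & ccw_order z].

(* Main.v *)
(* By Lagrange interpolation at the n+1 vertices, w lies in the n-polynomial hull
   iff the sum of the moduli of the Lagrange basis polynomials at w is at most 1;
   since their sum is 1, this means that all of these values are nonnegative
   reals.  The quotient of the values attached to z_i and z_{i+1} is
   -r e^{i S_i} with r > 0 and S_i = beta_i + sum_j alpha_{i,j}, so the condition
   becomes cos S_i = -1 for all i, hence S_i >= pi.  The S_i sum to (n+1) pi: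
   decompose the interior angle at z_j along w and add up the angles of the n+1
   triangles with apex w.  Hence S_i = pi for all i.
   For uniqueness, if w and w' are both in the hull, positivity of the Lagrange
   values makes the orientation of (w, w', z_j) have the same sign for all j,
   which is impossible for w in the convex hull of noncollinear points z_j. *)
Require Import Defs.
From mathcomp Require Import all_boot all_order all_algebra.
From mathcomp Require Import all_classical all_reals all_analysis.
From mathcomp Require Import ring lra.

Set Implicit Arguments.
Unset Strict Implicit.
Unset Printing Implicit Defensive.

Import Order.TTheory GRing.Theory Num.Theory.
Import ComplexField.Normc.

Local Open Scope classical_set_scope.
Local Open Scope ring_scope.
Local Open Scope complex_scope.

(** * Polar form of complex numbers with unsigned arguments *)

Section ComplexPolar.
Variable R : realType.
Implicit Types (x y z : R[i]) (t : R).

Lemma cmodE x : (cmod x)%:C = `|x|.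
Proof. by []. Qed.

Lemma cmod_ge0 x : 0 <= cmod x.
Proof. by case: x => a b; exact: sqrtr_ge0. Qed.

Lemma cmod_eq0 x : (cmod x == 0) = (x == 0).
Proof. by rewrite -(inj_eq (@complexI R)) cmodE normr_eq0. Qed.

Lemma cmod_gt0 x : (0 < cmod x) = (x != 0).
Proof. by rewrite lt_def cmod_eq0 cmod_ge0 andbT. Qed.

Lemma cmod_sqr x : cmod x ^+ 2 = complex.Re x ^+ 2 + complex.Im x ^+ 2.
Proof. by case: x => a b /=; rewrite sqr_sqrtr// addr_ge0// sqr_ge0. Qed.

Lemma cmod_real t : cmod t%:C = `|t|.
Proof. by rewrite /= expr0n addr0 sqrtr_sqr. Qed.

Lemma cmod_conj x : cmod x^* = cmod x.
Proof. by case: x => a b /=; rewrite sqrrN. Qed.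

Lemma Re_le_cmod x : complex.Re x <= cmod x.
Proof.
apply: le_trans (ler_norm _) _.
by rewrite -[leLHS]sqrtr_sqr; case: x => a b /=; rewrite ler_wsqrtr// lerDl sqr_ge0.
Qed.

Lemma cmod_sum (I : Type) (r : seq I) (Q : pred I) (f : I -> R[i]) :
  cmod (\sum_(i <- r | Q i) f i) <= \sum_(i <- r | Q i) cmod (f i).
Proof.
rewrite -lecR cmodE rmorph_sum/=; under [leRHS]eq_bigr => i _ do rewrite cmodE.
exact: ler_norm_sum.
Qed.

(** The gaps between modulus and real part are nonnegative and add up to at most [1 - 1], so each
    vanishes, which forces the imaginary part to be 0. *)
Lemma sum_cmod_le1_real (I : finType) (f : I -> R[i]) : \sum_i f i = 1 ->
  \sum_i cmod (f i) <= 1 -> forall i : I, f i = (cmod (f i))%:C.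
Proof.
move=> f1 cf1 i.
have Re_sum : \sum_j complex.Re (f j) = 1.
  by have /(congr1 (@complex.Re R)) := f1; rewrite (raddf_sum (@complex.Re R : Rcomplex R -> R)).
have ge0 j : 0 <= cmod (f j) - complex.Re (f j) by rewrite subr_ge0 Re_le_cmod.
have : \sum_j (cmod (f j) - complex.Re (f j)) == 0.
  by rewrite eq_le sumr_ge0// andbT sumrB Re_sum subr_le0.
rewrite psumr_eq0// => /allP/(_ i (mem_index_enum i)); rewrite subr_eq0 => /eqP Ref.
have := cmod_sqr (f i); rewrite Ref -[LHS]addr0 => /addrI/esym/eqP.
by rewrite sqrf_eq0; case: (f i) => a b /= /eqP->.
Qed.

Definition cis t : R[i] := cos t +i* sin t.

Lemma cisD s t : cis (s + t) = cis s * cis t.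
Proof.
by rewrite /cis cosD sinD; simpc; congr (_ +i* _); rewrite addrC mulrC [X in _ + X]mulrC.
Qed.

Lemma cis0 : cis 0 = 1.
Proof. by rewrite /cis cos0 sin0. Qed.

Lemma cis_sum (I : Type) (r : seq I) (P : pred I) (F : I -> R) :
  cis (\sum_(i <- r | P i) F i) = \prod_(i <- r | P i) cis (F i).
Proof. by apply: (big_morph cis cisD cis0). Qed.

(** For nonzero [x] this is the principal argument only on the closed upper half-plane; conjugate
    numbers share one value. *)
Definition arg x : R := acos (complex.Re x / cmod x).

Lemma Re_div_cmod_itv x : -1 <= complex.Re x / cmod x <= 1.
Proof.
have [->|x0] := eqVneq x 0; first by rewrite /= mul0r lerN10 ler01.
have m0 : 0 < cmod x by rewrite cmod_gt0.
rewrite ler_pdivlMr// ler_pdivrMr// mulN1r mul1r Re_le_cmod andbT.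
have := Re_le_cmod (- x); rewrite normcN; case: x {x0 m0} => a b /=; lra.
Qed.

Lemma arg_ge0 x : 0 <= arg x.
Proof. exact/acos_ge0/Re_div_cmod_itv. Qed.

Lemma arg_lepi x : arg x <= pi.
Proof. exact/acos_lepi/Re_div_cmod_itv. Qed.

Lemma cos_arg x : cos (arg x) = complex.Re x / cmod x.
Proof. by rewrite acosK// in_itv/= Re_div_cmod_itv. Qed.

(** The real parts agree by the choice of [arg]; the imaginary parts have equal squares, and both
    are nonnegative. *)
Lemma polarE x : 0 <= complex.Im x -> x = (cmod x)%:C * cis (arg x).
Proof.
move=> y0; have [->|x0] := eqVneq x 0; first by rewrite normc0 mul0r.
have m0 : 0 < cmod x by rewrite cmod_gt0.
have sx : cmod x * sin (arg x) = complex.Im x.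
  have s0 : 0 <= cmod x * sin (arg x).
    by rewrite mulr_ge0 ?cmod_ge0// sin_ge0_pi// arg_ge0 arg_lepi.
  apply/eqP; rewrite -(eqrXn2 (isT : (0 < 2)%N) s0 y0); apply/eqP.
  rewrite exprMn sin2cos2 cos_arg mulrBr mulr1 -exprMn [_ * (_ / _)]mulrC divfK ?gt_eqF//.
  by rewrite cmod_sqr [X in X - _]addrC addrK.
rewrite /cis; simpc; rewrite cos_arg sx [_ * (_ / _)]mulrC divfK ?gt_eqF//.
by case: x {x0 y0 m0 sx}.
Qed.

Lemma arg_cis t : 0 <= t <= pi -> arg (cis t) = t.
Proof.
move=> t0; rewrite /arg /= cos2Dsin2 sqrtr1 divr1 cosK// in_itv/=.
Qed.

Lemma arg_scale t x : 0 < t -> arg (t%:C * x) = arg x.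
Proof.
move=> t0; rewrite /arg normcM cmod_real gtr0_norm//.
case: x => a b /=; rewrite mul0r subr0 invfM mulrACA divff ?mul1r//.
by rewrite gt_eqF.
Qed.

Lemma cos_eqN1_ge_pi t : 0 <= t -> cos t = -1 -> pi <= t.
Proof.
move=> t0 ct; rewrite leNgt; apply/negP => tpi.
suff : -1 < cos t by rewrite ct ltxx.
rewrite -cospi ltr_cos// in_itv/= ?lexx ?pi_ge0 ?t0 ?ltW//.
Qed.

Lemma sin_lt0_pi t : pi < t < pi *+ 2 -> sin t < 0.
Proof.
move=> /andP[t1 t2]; rewrite -[t](subrK pi) sinDpi oppr_lt0 sin_gt0_pi//.
by rewrite subr_gt0 t1 ltrBlDr -mulr2n.
Qed.

(* The excluded case is the one where x and y are both negative reals. *)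
Lemma argM x y : x != 0 -> y != 0 ->
  0 <= complex.Im x -> 0 <= complex.Im y -> 0 <= complex.Im (x * y) ->
  arg x + arg y != pi *+ 2 -> arg (x * y) = arg x + arg y.
Proof.
move=> x0 y0 ix iy ixy npi.
have mx : 0 < cmod x by rewrite cmod_gt0.
have my : 0 < cmod y by rewrite cmod_gt0.
have E : x * y = (cmod x * cmod y)%:C * cis (arg x + arg y).
  by rewrite {1}(polarE ix) {1}(polarE iy) cisD rmorphM /= mulrACA.
rewrite E arg_scale ?mulr_gt0// arg_cis// addr_ge0 ?arg_ge0//=.
rewrite leNgt; apply/negP => gtpi.
have : sin (arg x + arg y) < 0.
  apply: sin_lt0_pi; rewrite gtpi lt_neqAle npi mulr2n lerD ?arg_lepi//.
apply/negP; rewrite -leNgt.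
move: ixy; rewrite E /cis; simpc => /=; rewrite pmulr_rge0// mulr_gt0//.
Qed.

Lemma arg_lt_pi x : 0 < complex.Re x -> arg x < pi.
Proof.
move=> x0; rewrite acos_ltpi//; have /andP[_ ->] := Re_div_cmod_itv x.
rewrite andbT; apply: lt_le_trans (ltrN10 _) _.
exact: divr_ge0 (ltW x0) (cmod_ge0 x).
Qed.

Lemma arg_oppc_conj x : arg (- conjc x) = pi - arg x.
Proof.
rewrite /arg -acosN ?Re_div_cmod_itv// normcN cmod_conj; congr acos.
by case: x => a b /=; rewrite mulNr.
Qed.

End ComplexPolar.

(** * Unsigned angles, orientation and half-planes *)

Section Angles.
Variable R : realType.
Implicit Types (a b c p w : R[i]).

(** Conjugating the other factor keeps the real part and makes the imaginary part [orient p a b], so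
    orientation hypotheses become the sign conditions of [polarE] and [argM]. *)
Lemma angleE a b p : angle a b p = arg (conjc (a - p) * (b - p)).
Proof.
rewrite /angle /arg normcM cmod_conj; congr (acos (_ / _)).
by case: (a - p) (b - p) => [x y] [s t] /=; ring.
Qed.

Lemma angle_ge0 a b p : 0 <= angle a b p.
Proof. by rewrite angleE arg_ge0. Qed.

Lemma angle_id a p : a != p -> angle a a p = 0.
Proof.
move=> ap; have m0 : 0 < cmod (a - p) by rewrite cmod_gt0 subr_eq0.
rewrite /angle -expr2 cmod_sqr -acos1; congr acos.
have : cmod (a - p) ^+ 2 != 0 by rewrite expf_neq0// gt_eqF.
rewrite cmod_sqr; case: (a - p) => x y /= xy0.
by rewrite mulrN opprK -!expr2 divff.
Qed.

Lemma orient_cyc a b c : orient a b c = orient b c a.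
Proof. by rewrite /orient; case: a b c => [? ?] [? ?] [? ?] /=; ring. Qed.

Lemma orient_id p a : orient p a a = 0.
Proof. by rewrite /orient; case: a p => [? ?] [? ?] /=; ring. Qed.

Lemma orient_neq p a b : orient p a b != 0 -> (a != p) && (b != p).
Proof.
apply: contraNT; rewrite negb_and !negbK => /orP[] /eqP->.
  by rewrite orient_cyc orient_cyc orient_id.
by rewrite orient_cyc orient_id.
Qed.

(** The numbers representing the two smaller angles multiply to a positive multiple of the one
    representing the large angle, so [argM] applies. *)
Lemma angleD p a b c : b != p -> 0 <= orient p a b -> 0 <= orient p b c ->
  0 < orient p a c -> angle a c p = angle a b p + angle b c p.
Proof.
move=> bp pab pbc pac.
have /andP[ap cp] := orient_neq (lt0r_neq0 pac).
have m0 : 0 < cmod (b - p) ^+ 2 by rewrite exprn_gt0// cmod_gt0 subr_eq0.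
have E : conjc (a - p) * (b - p) * (conjc (b - p) * (c - p)) =
    (cmod (b - p) ^+ 2)%:C * (conjc (a - p) * (c - p)).
  rewrite cmod_sqr; case: (a - p) (b - p) (c - p) => [? ?] [? ?] [? ?].
  by simpc => /=; congr (_ +i* _); ring.
have Im0 : 0 < complex.Im (conjc (a - p) * (b - p) * (conjc (b - p) * (c - p))).
  move: pac; rewrite E /orient; case: (conjc _ * (c - p)) => x y /=.
  by rewrite mul0r addr0 => y0; rewrite mulr_gt0.
rewrite !angleE -(arg_scale _ m0) -E.
apply: argM; rewrite ?mulf_neq0 ?conjc_eq0 ?subr_eq0 ?(ltW Im0)//.
(* If the arguments added up to [2 pi], both factors would be negative reals and their product would
   be real. *)
apply: contraTneq Im0 => arg2pi.
have ax : arg (conjc (a - p) * (b - p)) = pi.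
  apply/eqP; rewrite eq_le arg_lepi/= -(lerD2r pi) -mulr2n -arg2pi lerD2l.
  exact: arg_lepi.
have ay : arg (conjc (b - p) * (c - p)) = pi by move: arg2pi; rewrite ax mulr2n => /addrI.
rewrite (polarE pab) (polarE pbc) ax ay /cis cospi sinpi; simpc => /=.
by rewrite ltxx.
Qed.

(** The numbers representing the angles at [p] and [a] multiply to a positive multiple of the
    reflection [- conjc] of the one at [b], and this reflection has argument [pi] minus the angle at
    [b]. Degenerate triangles are included, since [w] may lie on an edge. *)
Lemma triangle_angle_sum a b p : a != b -> a != p -> b != p ->
  0 <= orient a b p -> angle a b p + angle b p a + angle p a b = pi.
Proof.
move=> ab ap bp abp.
have m0 : 0 < cmod (a - p) ^+ 2 by rewrite exprn_gt0// cmod_gt0 subr_eq0.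
have E : conjc (a - p) * (b - p) * (conjc (b - a) * (p - a)) =
    (cmod (a - p) ^+ 2)%:C * - conjc (conjc (p - b) * (a - b)).
  rewrite cmod_sqr; case: a b p {ab ap bp abp m0} => [? ?] [? ?] [? ?].
  by simpc => /=; congr (_ +i* _); ring.
suff -> : angle a b p + angle b p a = pi - angle p a b by rewrite subrK.
have Im0 : 0 <= complex.Im (- conjc (conjc (p - b) * (a - b))).
  by move: abp; rewrite orient_cyc /orient; case: (_ * _) => x y /=; rewrite opprK.
rewrite !angleE -arg_oppc_conj -(arg_scale (- _) m0) -E; apply/esym/argM.
- by rewrite mulf_neq0 ?conjc_eq0 ?subr_eq0.
- by rewrite mulf_neq0 ?conjc_eq0 ?subr_eq0// eq_sym.
- by rewrite -/(orient p a b) -orient_cyc -orient_cyc.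
- exact: abp.
- rewrite E; move: Im0; case: (- _) => x y /= y0.
  by rewrite mul0r addr0 mulr_ge0// ltW.
(* The scalar products at [a] and [p] add up to [|a - p|^2], so they cannot
   both be negative. *)
have : 0 < complex.Re (conjc (a - p) * (b - p)) +
           complex.Re (conjc (b - a) * (p - a)).
  move: m0; rewrite cmod_sqr; case: a b p {ab ap bp abp E Im0} => [? ?] [? ?] [? ?] /=.
  by congr (_ < _); ring.
have [re0 _|re0] := ltP 0 (complex.Re (conjc (a - p) * (b - p))).
  by rewrite lt_eqF// mulr2n ltr_leD ?arg_lepi ?arg_lt_pi.
move=> re1; rewrite lt_eqF// mulr2n ler_ltD ?arg_lepi ?arg_lt_pi//; lra.
Qed.

(** The preimage of a convex set [D] under a real affine function is convex and contains [K], hence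
    contains the hull. Open and closed half-planes are the cases needed. *)
Lemma convex_hull_Im (K : set R[i]) (D : set R) a c w :
  (forall s t (l : {i01 R}), D s -> D t -> D (l%:num * s + (1 - l%:num) * t)) ->
  (forall k, K k -> D (complex.Im (c * (k - a)))) ->
  convex_hull K w -> D (complex.Im (c * (w - a))).
Proof.
move=> convD KD hw.
apply: (@smallest_sub _ _ _ [set x | D (complex.Im (c * (x - a)))]) hw => //.
move=> x y l /set_mem xD /set_mem yD; apply/mem_set.
have := convD _ _ l xD yD; rewrite /=; congr D.
rewrite /conv/= {xD yD KD}.
case: x y a c => [? ?] [? ?] [? ?] [? ?] /=.
rewrite /unstable.onem; ring.
Qed.

Lemma convex_hull_Im_ge0 (K : set R[i]) a c w :
  (forall k, K k -> 0 <= complex.Im (c * (k - a))) ->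
  convex_hull K w -> 0 <= complex.Im (c * (w - a)).
Proof.
move=> KD; apply: (@convex_hull_Im K [set x | 0 <= x]) => // s t l /= s0 t0.
by rewrite addr_ge0// mulr_ge0// subr_ge0.
Qed.

Lemma convex_hull_Im_gt0 (K : set R[i]) a c w :
  (forall k, K k -> 0 < complex.Im (c * (k - a))) ->
  convex_hull K w -> 0 < complex.Im (c * (w - a)).
Proof.
move=> KD; apply: (@convex_hull_Im K [set x | 0 < x]) => // s t l /= s0 t0.
exact: (@convR_gt0 _ s t l).
Qed.

End Angles.

(** * Angle sums in a convex polygon *)

Section Polygon.
Variables (R : realType) (n : nat) (z : 'I_n.+1 -> R[i]).
Hypotheses (n_gt1 : (1 < n)%N) (z_inj : injective z) (z_ccw : ccw_order z).
Implicit Types (i j k : 'I_n.+1) (w : R[i]).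

Lemma ordS_val i : ordS i = (if (i < n)%N then i.+1 else 0%N) :> nat.
Proof.
rewrite /=; case: ltnP => [lin|ni]; first by rewrite modn_small.
have -> : nat_of_ord i = n by apply/eqP; rewrite eqn_leq ni andbT -ltnS.
by rewrite modnn.
Qed.

Lemma ordS_neq i : ordS i != i.
Proof.
rewrite -(inj_eq (@ord_inj _)) ordS_val; case: ltnP => ni; first by rewrite gtn_eqF.
by rewrite ltn_eqF//; apply: leq_trans ni; apply: ltnW.
Qed.

Lemma ordS2_neq i : ordS (ordS i) != i.
Proof.
rewrite -(inj_eq (@ord_inj _)) !ordS_val; case: (ltnP i n) => ni.
  case: ltnP => Sni; first by rewrite gtn_eqF.
  by rewrite ltn_eqF// -ltnS (leq_trans n_gt1).
by rewrite (ltnW n_gt1) ltn_eqF// (leq_trans n_gt1).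
Qed.

(** [ccw_order] speaks of increasing indices only; rotating the triangle cyclically handles a vertex
    preceding the edge, and the closing edge from the last vertex to the first. *)
Lemma orient_edge_gt0 j k : k != j -> k != ordS j ->
  0 < orient (z j) (z (ordS j)) (z k).
Proof.
rewrite -!(inj_eq (@ord_inj _)) ordS_val; have Sj := ordS_val j.
have := ltn_ord k; rewrite ltnS => kn.
case: ltnP Sj => [jn|nj] Sj kj kS.
  case: (ltngtP k j) kj => // [kj|jk] _.
    by rewrite -orient_cyc z_ccw// Sj.
  rewrite z_ccw ?Sj// ltn_neqAle eq_sym kS//.
rewrite orient_cyc z_ccw ?Sj// ?lt0n//; apply: (leq_trans _ nj).
rewrite ltn_neqAle kn andbT; apply: contraNneq kj => ->.
by rewrite eqn_leq nj -ltnS ltn_ord.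
Qed.

Lemma orient_edge_ge0 j k : 0 <= orient (z j) (z (ordS j)) (z k).
Proof.
have [->|kj] := eqVneq k j; first by rewrite orient_cyc orient_id.
have [->|kS] := eqVneq k (ordS j); first by rewrite orient_id.
exact/ltW/orient_edge_gt0.
Qed.

Lemma convex_hull_orient_ge0 j w :
  convex_hull (range z) w -> 0 <= orient (z j) (z (ordS j)) w.
Proof.
apply: convex_hull_Im_ge0 => _ [k _ <-]; exact: orient_edge_ge0.
Qed.

(** Seen from [z j], the other vertices appear in angular order starting at [z (ordS j)], so by
    [angleD] each summand is a difference of consecutive values of [theta] and the sum
    telescopes. *)
Lemma vertex_angle_sum j :
  \sum_(i | (z j != z i) && (z j != z (ordS i))) angle (z i) (z (ordS i)) (z j) =
  angle (z (ordS j)) (z (ord_pred j)) (z j).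
Proof.
pose theta k := angle (z (ordS j)) (z k) (z j).
have Pj_neq : ord_pred j != j by rewrite -{2}[j]ord_predK eq_sym ordS_neq.
under eq_bigl => i do rewrite !(inj_eq z_inj) ![j == _]eq_sym.
rewrite (eq_bigr (fun i => theta (ordS i) - theta i)) => [|i /andP[ij Sij]].
  rewrite sumrB; apply/eqP; rewrite subr_eq; apply/eqP.
  (* Both sides equal the sum over all [k != j]: the shifted sum lacks only [theta (ordS j)], which
     is 0, and the other lacks only [theta (ord_pred j)]. *)
  transitivity (\sum_(k | k != j) theta k).
    rewrite [RHS](bigD1 (ordS j)) ?ordS_neq//= {2}/theta.
    rewrite angle_id ?(inj_eq z_inj) ?ordS_neq// add0r.
    rewrite [RHS](reindex_inj (@ordS_inj _)).
    by apply: eq_bigl => i; rewrite (inj_eq (@ordS_inj _)) andbC.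
  rewrite (bigD1 (ord_pred j))//=; congr (_ + _); apply: eq_bigl => i.
  by rewrite -[i == ord_pred j](inj_eq (@ordS_inj _)) ord_predK.
apply/eqP; rewrite eq_sym subr_eq addrC eq_sym; apply/eqP/esym.
apply: angleD; rewrite ?(inj_eq z_inj) ?orient_edge_ge0//.
  by rewrite orient_cyc orient_edge_ge0.
by apply: orient_edge_gt0; rewrite ?(inj_eq (@ordS_inj _)).
Qed.

(** The quantity called [S_i] in the outline. *)
Definition edge_angle_sum w i : R := angle (z i) (z (ordS i)) w
  + \sum_(j | (z j != z i) && (z j != z (ordS i))) angle (z i) (z (ordS i)) (z j).

Lemma edge_angle_sum_ge0 w i : 0 <= edge_angle_sum w i.
Proof. by rewrite addr_ge0 ?angle_ge0// sumr_ge0// => j _; rewrite angle_ge0. Qed.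

(* By [vertex_angle_sum] the angles at [z j] add up to the interior angle there,
   which [w] splits into the angles at [z j] of the two triangles with apex [w]
   on the edges through [z j]; then each triangle contributes [pi]. *)
Lemma sum_edge_angle_sum w : convex_hull (range z) w -> ~ range z w ->
  \sum_i edge_angle_sum w i = \sum_(i < n.+1) pi.
Proof.
move=> hw wK; have zw i : z i != w by apply/eqP => zw; apply: wK; exists i.
have wz i : w != z i by rewrite eq_sym.
rewrite big_split/= (exchange_big_dep xpredT)//=.
under [X in _ + X]eq_bigr => j _ do rewrite vertex_angle_sum.
have split_vertex j : angle (z (ordS j)) (z (ord_pred j)) (z j) =
    angle (z (ordS j)) w (z j) + angle w (z (ord_pred j)) (z j).
  have SPj : ordS (ord_pred j) = j by exact: ord_predK.
  apply: angleD => //; first exact: convex_hull_orient_ge0.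
    by have := convex_hull_orient_ge0 (ord_pred j) hw; rewrite SPj orient_cyc.
  apply: orient_edge_gt0; rewrite -(inj_eq (@ordS_inj _)) SPj 1?eq_sym ?ordS_neq//.
  exact: ordS2_neq.
under [X in _ + X]eq_bigr => j _ do rewrite split_vertex.
(* The shift of index moves the second half of the angle at [z (ordS i)] to the summand of [i],
   which then holds the three angles of the triangle on edge [i] with apex [w]. *)
rewrite big_split/= [X in _ + (_ + X)](reindex_inj (@ordS_inj _))/= -!big_split/=.
apply: eq_bigr => i _; rewrite ordSK addrA; apply: triangle_angle_sum => //.
  by rewrite (inj_eq z_inj) eq_sym ordS_neq.
exact: convex_hull_orient_ge0.
Qed.

Lemma edge_angle_sum_eq_pi w : convex_hull (range z) w -> ~ range z w ->
  (forall i, cos (edge_angle_sum w i) = -1) -> forall i, edge_angle_sum w i = pi.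
Proof.
move=> hw wK cosN1 i.
have gepi j : 0 <= edge_angle_sum w j - pi.
  by rewrite subr_ge0 cos_eqN1_ge_pi ?edge_angle_sum_ge0.
have : \sum_j (edge_angle_sum w j - pi) == 0.
  by rewrite sumrB sum_edge_angle_sum// subrr.
by rewrite psumr_eq0// => /allP/(_ i (mem_index_enum i)); rewrite subr_eq0 => /eqP.
Qed.

End Polygon.

(** * Lagrange interpolation over a field *)

Section Lagrange.
Variables (F : fieldType) (n : nat) (z : 'I_n.+1 -> F).
Hypothesis z_inj : injective z.
Implicit Types (w : F) (i j k : 'I_n.+1) (P : {poly F}).

Definition lagrange_val w j : F := \prod_(k | k != j) ((w - z k) / (z j - z k)).

Definition lagrange_poly j : {poly F} :=
  (\prod_(k | k != j) (z j - z k))^-1 *: \prod_(k | k != j) ('X - (z k)%:P).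

Lemma horner_lagrange_poly j w : (lagrange_poly j).[w] = lagrange_val w j.
Proof.
rewrite /lagrange_poly /lagrange_val hornerZ horner_prod prodf_div mulrC.
by congr (_ / _); apply: eq_bigr => k _; rewrite hornerXsubC.
Qed.

Lemma size_lagrange_poly j : (size (lagrange_poly j) <= n.+1)%N.
Proof.
apply: leq_trans (size_scale_leq _ _) _.
rewrite -big_filter size_prod_XsubC.
by have [e _ _ [_ ->]] := big_enumP; rewrite cardC1 card_ord.
Qed.

Lemma lagrange_val_node i j : lagrange_val (z i) j = (i == j)%:R.
Proof.
rewrite /lagrange_val; have [->|ij] := eqVneq i j.
  by apply: big1 => k kj; rewrite divff// subr_eq0 (inj_eq z_inj) eq_sym.
by rewrite (bigD1 i)//= subrr !mul0r.
Qed.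

Lemma lagrange_val_neq0 w j : (forall i, w != z i) -> lagrange_val w j != 0.
Proof.
move=> wz; apply/prodf_neq0 => k kj.
by rewrite mulf_neq0 ?invr_eq0 ?subr_eq0 ?wz// (inj_eq z_inj) eq_sym.
Qed.

(** The difference [Q] of [P] and its interpolant has size at most [n.+1] and vanishes at [n.+1]
    distinct nodes. *)
Lemma lagrange_interpolation P w : (size P <= n.+1)%N ->
  P.[w] = \sum_j P.[z j] * lagrange_val w j.
Proof.
move=> sP; pose Q := P - \sum_j P.[z j] *: lagrange_poly j.
suff : Q = 0.
  move/eqP; rewrite subr_eq0 => /eqP {1}->; rewrite horner_sum.
  by apply: eq_bigr => j _; rewrite hornerZ horner_lagrange_poly.
have sQ : (size Q <= size (map z (enum 'I_n.+1)))%N.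
  rewrite size_map size_enum_ord (leq_trans (size_polyD _ _))// geq_max sP size_polyN.
  apply: (leq_trans (size_sum _ _ _)); apply/bigmax_leqP => j _.
  exact: leq_trans (size_scale_leq _ _) (size_lagrange_poly j).
apply: (roots_geq_poly_eq0 _ _ sQ); last by rewrite map_inj_uniq// enum_uniq.
apply/allP => _ /mapP[i _ ->]; rewrite rootE hornerD hornerN horner_sum.
rewrite (bigD1 i)//= big1 => [|j ji].
  by rewrite hornerZ horner_lagrange_poly lagrange_val_node eqxx mulr1 addr0 subrr.
by rewrite hornerZ horner_lagrange_poly lagrange_val_node eq_sym (negbTE ji) mulr0.
Qed.

Lemma sum_lagrange_val w : \sum_j lagrange_val w j = 1.
Proof.
rewrite -[RHS](hornerC 1 w) lagrange_interpolation ?size_poly1//.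
by apply: eq_bigr => j _; rewrite hornerC mul1r.
Qed.

(** The factors [w - z k] common to both products cancel; the minus sign comes from [z i - z j]
    against [z j - z i]. The remaining quotients compare [z j] with [z i] as seen from [w] and from
    the other nodes. *)
Lemma lagrange_val_ratio w i j : i != j -> (forall k, w != z k) ->
  lagrange_val w i = - ((z j - w) / (z i - w) *
    \prod_(k | (k != i) && (k != j)) ((z j - z k) / (z i - z k))) * lagrange_val w j.
Proof.
move=> ij wz; have -> : lagrange_val w j = (w - z i) / (z j - z i) *
    \prod_(k | (k != i) && (k != j)) ((w - z k) / (z j - z k)).
  by rewrite /lagrange_val (bigD1 i)//=; congr (_ * _); apply: eq_bigl => k; rewrite andbC.
rewrite /lagrange_val (bigD1 j) 1?eq_sym//=.
rewrite mulNr mulrACA -big_split/= -mulNr; congr (_ * _).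
  have zji : z j - z i != 0 by rewrite subr_eq0 (inj_eq z_inj) eq_sym.
  have zij : z i - z j != 0 by rewrite subr_eq0 (inj_eq z_inj).
  have zwi : z i - w != 0 by rewrite subr_eq0 eq_sym.
  by field; rewrite zji zij zwi.
apply: eq_bigr => k /andP[ki kj].
have zjk : z j - z k != 0 by rewrite subr_eq0 (inj_eq z_inj) eq_sym.
have zik : z i - z k != 0 by rewrite subr_eq0 (inj_eq z_inj) eq_sym.
by field; rewrite zjk zik.
Qed.

(** Cross-multiplied form of the fact that the value at [w], times [w - z j] and divided by the
    nodal polynomial at [w], is the barycentric weight of [z j], independent of [w]. *)
Lemma lagrange_val_nodal w w' j :
  lagrange_val w' j * (w' - z j) * \prod_k (w - z k) =
  lagrange_val w j * (w - z j) * \prod_k (w' - z k).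
Proof.
rewrite [\prod_k (w - z k)](bigD1 j)//= [\prod_k (w' - z k)](bigD1 j)//=.
rewrite /lagrange_val !prodf_div; ring.
Qed.

End Lagrange.

(** * The polynomial hull of finitely many points; quotients in polar form *)

Section Hull.
Variables (R : realType) (n : nat) (z : 'I_n.+1 -> R[i]).
Hypothesis z_inj : injective z.
Implicit Types (w : R[i]) (i j k : 'I_n.+1) (P : {poly R[i]}).

Lemma cmod_le_poly_norm P j : cmod P.[z j] <= poly_norm (range z) P.
Proof.
apply: ub_le_sup; last by exists (z j) => //; exists j.
(* An upper bound is needed for [sup] to be meaningful; on finitely many nodes the sum of the moduli
   serves. *)
exists (\sum_k cmod P.[z k]) => _ [_ [k _ <-] <-].
by rewrite (bigD1 k)//= lerDl sumr_ge0// => i _; exact: cmod_ge0.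
Qed.

Lemma poly_hull_lagrange w : poly_hull n (range z) w <->
  \sum_j cmod (lagrange_val z w j) <= 1.
Proof.
split=> [hw|lebesgue P sP]; last first.
  rewrite (lagrange_interpolation z_inj _ sP); apply: le_trans (cmod_sum _ _ _) _.
  apply: (@le_trans _ _ (\sum_j poly_norm (range z) P * cmod (lagrange_val z w j))).
    by apply: ler_sum => j _; rewrite normcM ler_wpM2r ?cmod_ge0// cmod_le_poly_norm.
  rewrite -mulr_sumr ler_piMr//.
  exact: le_trans (cmod_ge0 _) (cmod_le_poly_norm P ord0).
pose L := lagrange_val z w.
(* The polynomial extremal for the Lebesgue constant at [w]: of modulus at most 1
   on the nodes, with value [\sum_j cmod (L j)] at [w]. *)
pose c j : R[i] := conjc (L j) / (cmod (L j))%:C.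
pose P := \sum_j c j *: lagrange_poly z j.
have Pw : P.[w] = \sum_j (cmod (L j))%:C.
  rewrite horner_sum; apply: eq_bigr => j _; rewrite hornerZ horner_lagrange_poly -/(L j) /c.
  have [->|Lj0] := eqVneq (L j) 0; first by rewrite mulr0 normc0.
  rewrite mulrAC mulrC; apply: (canLR (mulKf _)).
    by rewrite cmodE normr_eq0.
  by rewrite mulrC -sqr_normc cmodE expr2.
have Pz j : cmod P.[z j] <= 1.
  rewrite horner_sum (bigD1 j)//= big1 => [|k kj]; last first.
    by rewrite hornerZ horner_lagrange_poly lagrange_val_node// eq_sym (negbTE kj) mulr0.
  rewrite hornerZ horner_lagrange_poly lagrange_val_node// eqxx mulr1 addr0 /c.
  rewrite normcM normcV cmod_conj cmod_real ger0_norm ?cmod_ge0//.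
  (* Division by zero gives 0, so [P] vanishes at a node with [L j = 0] and the bound still
     holds. *)
  have [->|Lj0] := eqVneq (cmod (L j)) 0; first by rewrite mul0r.
  by rewrite divff.
have sP : (size P <= n.+1)%N.
  apply: (leq_trans (size_sum _ _ _)); apply/bigmax_leqP => j _.
  exact: leq_trans (size_scale_leq _ _) (size_lagrange_poly _ _).
have := hw _ sP; rewrite Pw -rmorph_sum cmod_real ger0_norm; last first.
  by rewrite sumr_ge0// => j _; exact: cmod_ge0.
move=> /le_trans; apply; apply: ge_sup.
  by exists (cmod P.[z ord0]); exists (z ord0) => //; exists ord0.
by move=> _ [_ [k _ <-] <-].
Qed.

Lemma poly_hull_lagrange_ge0 w : poly_hull n (range z) w ->
  forall j, lagrange_val z w j = (cmod (lagrange_val z w j))%:C.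
Proof.
by move=> /poly_hull_lagrange; apply: sum_cmod_le1_real; exact: sum_lagrange_val.
Qed.

(** The quotient is a positive multiple of [conjc (a - p) * (b - p)]; the orientation puts it in the
    closed upper half-plane, where the unsigned angle is its argument. *)
Lemma div_polarE (a b p : R[i]) : a != p -> 0 <= orient a b p ->
  (b - p) / (a - p) = (cmod ((b - p) / (a - p)))%:C * cis (angle a b p).
Proof.
move=> ap abp; have m0 : 0 < cmod (a - p) by rewrite cmod_gt0 subr_eq0.
have ap0 : a - p != 0 by rewrite subr_eq0.
have E : (b - p) / (a - p) = (cmod (a - p) ^- 2)%:C * (conjc (a - p) * (b - p)).
  have -> : (cmod (a - p) ^- 2)%:C = ((a - p) * conjc (a - p))^-1.
    by rewrite -sqr_normc -cmodE -rmorphXn -fmorphV.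
  by rewrite invfM mulrA mulfVK ?conjc_eq0// mulrC.
have r0 : 0 < cmod (a - p) ^- 2 by rewrite invr_gt0 exprn_gt0.
rewrite angleE -(arg_scale _ r0) -E; apply: polarE; rewrite E.
move: abp; rewrite -orient_cyc /orient; case: (_ * _) => x y /= y0.
by rewrite mul0r addr0 mulr_ge0// ltW.
Qed.

Lemma collinear_orient (a b c w w' : R[i]) : w != w' ->
  orient w w' a = 0 -> orient w w' b = 0 -> orient w w' c = 0 -> orient a b c = 0.
Proof.
move=> ww' oa ob oc; apply/eqP; rewrite -(inj_eq (@complexI R)) rmorph0.
(* Writing [x] for the planar cross product, with [e = w' - w], [u = b - a], [v = c - a], this is
   the identity [(u x v) e = (e x v) u - (e x u) v]. *)
have : (orient a b c)%:C * (w' - w) = (orient w w' c - orient w w' a)%:C * (b - a)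
    - (orient w w' b - orient w w' a)%:C * (c - a).
  rewrite /orient; case: a b c w w' {ww' oa ob oc} => [? ?] [? ?] [? ?] [? ?] [? ?] /=.
  by simpc; congr (_ +i* _); ring.
rewrite oa ob oc !subrr !mul0r subrr => /eqP; rewrite mulf_eq0 => /orP[//|].
by rewrite subr_eq0 eq_sym (negbTE ww').
Qed.

End Hull.

(** * Hull points of a convex polygon: angle criterion and uniqueness *)

Section PolygonHull.
Variables (R : realType) (n : nat) (z : 'I_n.+1 -> R[i]).
Hypotheses (n_gt1 : (1 < n)%N) (z_inj : injective z) (z_ccw : ccw_order z).
Implicit Types (w : R[i]) (i j : 'I_n.+1).
Local Notation L := (lagrange_val z).

Lemma ordS_invariant (T : Type) (f : 'I_n.+1 -> T) :
  (forall i, f i = f (ordS i)) -> forall i, f i = f ord0.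
Proof.
move=> fS [m mn]; elim: m mn => [|m IH] mn; first by congr f; apply: val_inj.
rewrite -(IH (ltnW mn)) [RHS]fS; congr f; apply: ord_inj.
by rewrite ordS_val ifT.
Qed.

(** From [w] and from every other vertex, the edge from [z i] to [z (ordS i)] is seen with
    nonnegative orientation, so [div_polarE] applies to each factor of [lagrange_val_ratio] and the
    angles add up. *)
Lemma lagrange_val_edge w i : convex_hull (range z) w -> (forall k, w != z k) ->
  exists2 r, 0 < r & L w i = - (r%:C * cis (edge_angle_sum z w i)) * L w (ordS i).
Proof.
move=> hw wz; have iS : i != ordS i by rewrite eq_sym ordS_neq.
exists (cmod ((z (ordS i) - w) / (z i - w) * \prod_(k | (k != i) && (k != ordS i))
    ((z (ordS i) - z k) / (z i - z k)))).
  rewrite cmod_gt0 mulf_neq0//.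
    by rewrite mulf_neq0 ?invr_eq0// subr_eq0 eq_sym.
  apply/prodf_neq0 => k /andP[ki kS].
  by rewrite mulf_neq0 ?invr_eq0// subr_eq0 (inj_eq z_inj) eq_sym.
rewrite (lagrange_val_ratio z_inj iS wz); congr (- _ * _).
under [in RHS]eq_bigl => k do rewrite -(inj_eq z_inj) -[k == ordS i](inj_eq z_inj).
under eq_bigl => k do rewrite -(inj_eq z_inj) -[k == ordS i](inj_eq z_inj).
rewrite normcM rmorphM/= cisD mulrACA cis_sum; congr (_ * _).
  by apply: div_polarE; [rewrite eq_sym|exact: convex_hull_orient_ge0].
rewrite (big_morph _ (@normcM R) (@normc1 R)) rmorph_prod -big_split/=.
apply: eq_bigr => k /andP[ki kS]; apply: div_polarE; first by rewrite eq_sym.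
exact: orient_edge_ge0.
Qed.

Lemma poly_hull_angles w : ~ range z w -> convex_hull (range z) w ->
  poly_hull n (range z) w <-> forall i, edge_angle_sum z w i = pi.
Proof.
move=> wK hw; have wz k : w != z k by apply/eqP => wzk; apply: wK; exists k.
have Lneq0 j : L w j != 0 by exact: lagrange_val_neq0.
split=> [/(poly_hull_lagrange_ge0 z_inj) L_ge0|S_pi].
  apply: edge_angle_sum_eq_pi => // i.
  have [r r0] := lagrange_val_edge i hw wz.
  rewrite L_ge0 [L w (ordS i)]L_ge0 mulNr mulrAC -rmorphM/= => E.
  have rL0 : 0 < r * cmod (L w (ordS i)) by rewrite mulr_gt0// cmod_gt0.
  have cmod_cis t : cmod (cis t) = 1 :> R by rewrite /cis /= cos2Dsin2 sqrtr1.
  (* Moduli identify [r * cmod (L w (ordS i))] with [cmod (L w i)]; real parts then leave [cos] of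
     the angle sum equal to -1. *)
  have := congr1 (@cmod R) E; rewrite normcN normcM cmod_cis mulr1 !cmod_real.
  rewrite ger0_norm ?cmod_ge0// gtr0_norm// => Lr.
  move/(congr1 (@complex.Re R)): E; rewrite Lr /cis /= mul0r subr0.
  move/(congr1 -%R); rewrite opprK -[LHS]mulrN1 => /(mulfI (lt0r_neq0 rL0)).
  by move<-.
apply/poly_hull_lagrange => //.
(* When every angle sum is [pi], consecutive Lagrange values have positive quotients, so all share
   one unimodular phase. Taking moduli in their sum, which is 1, shows that their moduli add up to
   1. *)
pose phase j := L w j / (cmod (L w j))%:C.
have phaseS i : phase i = phase (ordS i).
  have [r r0] := lagrange_val_edge i hw wz.
  rewrite S_pi /cis cospi sinpi complexr0 rmorphN1 mulrN1 opprK /phase => ->.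
  rewrite normcM cmod_real gtr0_norm// rmorphM/= invfM mulrACA divff ?mul1r//.
  by rewrite -(rmorph0 (real_complex R)) (inj_eq (@complexI R)) gt_eqF.
have cL0 j : (cmod (L w j))%:C != 0 by rewrite cmodE normr_eq0.
have L_phase j : L w j = phase ord0 * (cmod (L w j))%:C.
  by rewrite -(ordS_invariant phaseS j) /phase divfK.
have phase1 : cmod (phase ord0) = 1.
  by rewrite /phase normcM normcV cmod_real ger0_norm ?cmod_ge0// divff// cmod_eq0.
have := sum_lagrange_val z_inj w; under eq_bigr => j _ do rewrite L_phase.
rewrite -mulr_sumr -rmorph_sum => /(congr1 (@cmod R)).
rewrite normcM phase1 mul1r cmod_real normc1 => <-; exact: ler_norm.
Qed.

(** With positive Lagrange values, [lagrange_val_nodal] makes [(w' - z j) / (w - z j)] a positive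
    multiple of [omega' / omega], which does not depend on [j]; the sign of its imaginary part is
    that of [orient w w' (z j)]. *)
Lemma lagrange_sign w w' : (forall k, w != z k) -> (forall k, w' != z k) ->
  poly_hull n (range z) w -> poly_hull n (range z) w' ->
  exists c : R, forall j, exists2 r, 0 < r & orient w w' (z j) = r * c.
Proof.
move=> wz w'z hw hw'.
pose omega := \prod_k (w - z k); pose omega' := \prod_k (w' - z k).
exists (complex.Im (omega' * conjc omega)) => j.
have omega0 : omega != 0 by apply/prodf_neq0 => k _; rewrite subr_eq0.
have lw : 0 < cmod (L w j) by rewrite cmod_gt0 lagrange_val_neq0.
have lw' : 0 < cmod (L w' j) by rewrite cmod_gt0 lagrange_val_neq0.
have wj : 0 < cmod (w - z j) ^+ 2 by rewrite exprn_gt0// cmod_gt0 subr_eq0.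
have om : 0 < cmod omega ^+ 2 by rewrite exprn_gt0// cmod_gt0.
have p0 : 0 < cmod (L w' j) * cmod omega ^+ 2 by rewrite mulr_gt0.
exists (cmod (L w j) * cmod (w - z j) ^+ 2 / (cmod (L w' j) * cmod omega ^+ 2)).
  exact: divr_gt0 (mulr_gt0 lw wj) p0.
apply: (mulfI (lt0r_neq0 p0)).
rewrite [RHS]mulrA [_ * (_ / _)]mulrC divfK ?gt_eqF//.
set l := cmod (L w j); set l' := cmod (L w' j).
(* Multiplying by these conjugates turns [w - z j] and [omega] into squared moduli, so that only
   positive real factors surround the two products to compare. *)
have := congr1 ( *%R^~ (conjc (w - z j) * conjc omega)) (lagrange_val_nodal z w w' j).
rewrite (poly_hull_lagrange_ge0 z_inj hw) (poly_hull_lagrange_ge0 z_inj hw').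
rewrite -/omega -/omega' -/l -/l'.
have -> : l'%:C * (w' - z j) * omega * (conjc (w - z j) * conjc omega) =
    (l' * cmod omega ^+ 2)%:C * ((w' - z j) * conjc (w - z j)).
  rewrite [(l' * _)%:C]rmorphM rmorphXn /= cmodE sqr_normc; ring.
have -> : l%:C * (w - z j) * omega' * (conjc (w - z j) * conjc omega) =
    (l * cmod (w - z j) ^+ 2)%:C * (omega' * conjc omega).
  rewrite [(l * _)%:C]rmorphM rmorphXn /= cmodE sqr_normc; ring.
have -> : orient w w' (z j) = complex.Im ((w' - z j) * conjc (w - z j)).
  by rewrite /orient; case: w w' (z j) {hw hw' omega omega' omega0 lw lw' wj om p0 l l' wz w'z}
    => [? ?] [? ?] [? ?] /=; ring.
move/(congr1 (@complex.Im R)).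
by case: (_ * conjc (w - z j)) (omega' * _) => [? ?] [? ?] /=; rewrite !mul0r !addr0.
Qed.

Lemma poly_hull_unique w w' :
  ~ range z w -> convex_hull (range z) w -> poly_hull n (range z) w ->
  ~ range z w' -> poly_hull n (range z) w' -> w = w'.
Proof.
move=> wK cw hw w'K hw'.
have wz k : w != z k by apply/eqP => wzk; apply: wK; exists k.
have w'z k : w' != z k by apply/eqP => wzk; apply: w'K; exists k.
apply/eqP/negPn/negP => ww'.
have [c sgn] := lagrange_sign wz w'z hw hw'.
(* For nonzero [c] all vertices lie strictly on one side of the line through [w] and [w'], hence so
   does [w] itself, which is absurd. *)
have [c0|c0|c0] := ltgtP c 0.
- suff : 0 < complex.Im (- conjc (w' - w) * (w - w)) by rewrite subrr mulr0 ltxx.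
  apply: convex_hull_Im_gt0 cw => _ [j _ <-].
  have [r r0 E] := sgn j.
  have : orient w w' (z j) < 0 by rewrite E pmulr_rlt0.
  by rewrite /orient mulNr; case: (_ * _) => ? ? /=; rewrite oppr_gt0.
- suff : 0 < complex.Im (conjc (w' - w) * (w - w)) by rewrite subrr mulr0 ltxx.
  apply: convex_hull_Im_gt0 cw => _ [j _ <-].
  by have [r r0 E] := sgn j; rewrite -/(orient w w' (z j)) E mulr_gt0.
(* Otherwise all vertices lie on that line, although the first three form a nondegenerate
   triangle. *)
have ori0 j : orient w w' (z j) = 0 by have [r _ ->] := sgn j; rewrite c0 mulr0.
have : 0 < orient (z ord0) (z (ordS ord0)) (z (ordS (ordS ord0))).
  by apply: orient_edge_gt0 => //; [exact: ordS2_neq|exact: ordS_neq].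
by rewrite (collinear_orient ww')// ltxx.
Qed.

End PolygonHull.

Local Close Scope complex_scope.

Theorem proposition9 (R : realType) (n : nat) (z : 'I_n.+1 -> R[i]) :
  (1 < n)%N ->
  ccw_convex_polygon z ->
  (forall w : R[i], ~ range z w -> convex_hull (range z) w ->
     poly_hull n (range z) w <->
     (forall i : 'I_n.+1,
        angle (z i) (z (ordS i)) w
        + \sum_(j : 'I_n.+1 | (z j != z i) && (z j != z (ordS i)))
            angle (z i) (z (ordS i)) (z j)
        = pi)) /\
  (forall w w' : R[i],
     ~ range z w -> convex_hull (range z) w -> poly_hull n (range z) w ->
     ~ range z w' -> convex_hull (range z) w' -> poly_hull n (range z) w' ->
     w = w').
Proof.
move=> n_gt1 [z_inj _ z_ccw]; split=> [w wK cw|w w' wK cw hw w'K _ hw'].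
  exact: poly_hull_angles.
exact: (poly_hull_unique n_gt1 z_inj z_ccw).
Qed.
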